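(* Let $F$ be the standardised arcsine law, i.e. the law of $\sqrt{2}\cos\Theta$ with $\Theta$ uniformly distributed on $[0,2\pi)$. Then for every integer $d\ge 1$, $$S_d^F = P_d \quad\Longleftrightarrow\quad d \le 5 .$$
   Context: For an integer $d\ge 1$, $P_d$ denotes the set of real symmetric positive semidefinite $d\times d$ matrices with unit diagonal (the set of $d\times d$ correlation matrices). A law (probability distribution) $F$ on $\mathbb{R}$ is called standardised if it has mean $0$ and variance $1$. For a standardised law $F$, $S_d^F$ denotes the set of correlation matrices of $d$-dimensional random vectors whose margins are all $F$ (the joint distribution being otherwise arbitrary). The standardised arcsine law is equivalently the image of the $\mathrm{Beta}(\tfrac12,\tfrac12)$ law on $[0,1]$ under the affine map $t\mapsto \sqrt{2}\,(2t-1)$; it is supported on $[-\sqrt2,\sqrt2]$ and has mean $0$ and variance $1$. *)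

(* Defs.v *)
From HB Require Import structures.
From mathcomp Require Import all_boot all_order all_algebra.
From mathcomp Require Import all_classical all_reals all_analysis.
From mathcomp Require Import measurable_realfun.

Set Implicit Arguments.
Unset Strict Implicit.
Unset Printing Implicit Defensive.

Import Order.TTheory GRing.Theory Num.Theory.
Import numFieldNormedType.Exports.

Local Open Scope classical_set_scope.
Local Open Scope ring_scope.

Definition psd (R : realType) (d : nat) (A : 'M[R]_d) : Prop :=
  A^T = A /\ forall v : 'cV[R]_d, 0 <= (v^T *m A *m v) ord0 ord0.

Definition correlation_matrices (R : realType) (d : nat) : set 'M[R]_d :=
  [set A | psd A /\ forall i, A i i = 1].
Arguments correlation_matrices R d : clear implicits.

(* [fine] sends infinite values to 0 and division by 0 gives 0, so this is the
   usual correlation coefficient only when both variances are finite and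
   nonzero, as holds for standardised margins. *)
Definition correlation (R : realType) (disp : measure_display)
    (T : measurableType disp) (P : probability T R) (X Y : {RV P >-> R}) : R :=
  fine (covariance P X Y) /
    (Num.sqrt (fine 'V_P[X]) * Num.sqrt (fine 'V_P[Y])).

Definition correlation_matrix (R : realType) (disp : measure_display)
    (T : measurableType disp) (P : probability T R) (d : nat)
    (X : 'I_d -> {RV P >-> R}) : 'M[R]_d :=
  \matrix_(i, j) correlation (X i) (X j).

(* Laws are compared on Borel sets only: a measure is a function on all
   subsets, and its values off the sigma-algebra carry no meaning. *)
Definition has_law (R : realType) (disp : measure_display)
    (T : measurableType disp) (P : probability T R) (X : {RV P >-> R})
    (F : probability R R) : Prop :=
  forall A : set R, measurable A -> distribution P X A = F A.

(* The set S_d^F; a d-dimensional random vector is a family of d random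
   variables on a common, arbitrary probability space. *)
Definition margin_correlation_matrices (R : realType)
    (F : probability R R) (d : nat) : set 'M[R]_d :=
  [set A | exists (disp : measure_display) (T : measurableType disp)
      (P : probability T R) (X : 'I_d -> {RV P >-> R}),
    (forall i, has_law (X i) F) /\ A = correlation_matrix X].
Arguments margin_correlation_matrices {R} F d.

Lemma two_pi_gt0 (R : realType) : 0 < 2 * pi :> R.
Proof. by rewrite mulr_gt0 // pi_gt0. Qed.

Definition sqrt2_cos (R : realType) (theta : measurableTypeR R) : R :=
  Num.sqrt 2 * cos theta.

Lemma measurable_sqrt2_cos (R : realType) :
  measurable_fun [set: measurableTypeR R] (@sqrt2_cos R).
Proof.
apply: measurable_funM; first exact: measurable_cst.
apply: (@continuous_measurable_fun R cos); exact: continuous_cos.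
Qed.

HB.instance Definition _ (R : realType) :=
  isMeasurableFun.Build _ _ _ _ (@sqrt2_cos R) (@measurable_sqrt2_cos R).

(* [uniform_prob] is uniform on the closed interval [0, 2 pi]; the added
   endpoint is Lebesgue-null, so this is also the uniform law on [0, 2 pi[. *)
Definition arcsine_law (R : realType) : probability R R :=
  distribution (uniform_prob (two_pi_gt0 R)) (@sqrt2_cos R).

(* Main.v *)
(* For [d <= 5] the extreme points of the elliptope have rank at most 2: along a
   face through [A] of rank [r] there are [r (r + 1) / 2] symmetric directions
   but only [d] diagonal constraints, so if [r >= 3] one can move from [A] in
   both directions until the rank drops, which makes [A] a mixture of two
   correlation matrices of smaller rank. A correlation matrix of rank at most 2
   has entries [cos (t_i - t_j)] and is realised by [sqrt 2 cos (Theta + t_i)];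
   attainable matrices are closed under mixtures of laws.
   For [d >= 6] take the Gram matrix of the six diagonals [v_i] of a regular
   icosahedron. An attaining vector is almost surely [X_i = <v_i, Y>] with [Y] in
   [R^3], and [sum_i <v_i, y>^4 = (6/5) |y|^4], [sum_i <v_i, y>^2 = 2 |y|^2]. With
   [E X_i^2 = 1] and [E X_i^4 = 3/2] this gives [E |Y|^2 = 3] and
   [E |Y|^4 = 15/2 < 9], contradicting Jensen's inequality. *)
Require Import Defs.
From HB Require Import structures.
From mathcomp Require Import all_boot all_order all_algebra.
From mathcomp Require Import all_classical all_reals all_analysis.
From mathcomp Require Import measurable_realfun.
From mathcomp Require Import ring lra.

Set Implicit Arguments.
Unset Strict Implicit.
Unset Printing Implicit Defensive.

Import Order.TTheory GRing.Theory Num.Theory.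
Import numFieldNormedType.Exports.

Local Open Scope classical_set_scope.
Local Open Scope ring_scope.

(** * Bilinear forms of matrices: Cauchy-Schwarz, factorisation and perturbation of semidefinite
    matrices *)

Section PositiveSemidefinite.
Variables (R : realType) (d : nat).
Implicit Types (A B : 'M[R]_d) (x y : 'cV[R]_d).

Definition bform A x y : R := (x^T *m A *m y) ord0 ord0.

Lemma bformDl A x y z : bform A (x + y) z = bform A x z + bform A y z.
Proof. by rewrite /bform linearD /= !mulmxDl mxE. Qed.

Lemma bformDr A x y z : bform A x (y + z) = bform A x y + bform A x z.
Proof. by rewrite /bform mulmxDr mxE. Qed.

Lemma bformZl A a x y : bform A (a *: x) y = a * bform A x y.
Proof. by rewrite /bform linearZ /= -!scalemxAl mxE. Qed.

Lemma bformZr A a x y : bform A x (a *: y) = a * bform A x y.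
Proof. by rewrite /bform -scalemxAr mxE. Qed.

Lemma bformD A B x y : bform (A + B) x y = bform A x y + bform B x y.
Proof. by rewrite /bform mulmxDr mulmxDl mxE. Qed.

Lemma bformZ a A x y : bform (a *: A) x y = a * bform A x y.
Proof. by rewrite /bform -scalemxAr -scalemxAl mxE. Qed.

Lemma bformC A x y : A^T = A -> bform A x y = bform A y x.
Proof.
move=> As; rewrite /bform; have <- : (x^T *m A *m y)^T = y^T *m A *m x.
  by rewrite !trmx_mul trmxK As mulmxA.
by rewrite [RHS]mxE.
Qed.

Lemma bformE A x y : bform A x y = \sum_i \sum_j x i ord0 * A i j * y j ord0.
Proof.
rewrite /bform mxE exchange_big /=; apply: eq_bigr => j _.
by rewrite mxE mulr_suml; apply: eq_bigr => i _; rewrite mxE.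
Qed.

Lemma bform_delta A i j : bform A (delta_mx i ord0) (delta_mx j ord0) = A i j.
Proof. by rewrite /bform trmx_delta -rowE -colE !mxE. Qed.

(** Cauchy-Schwarz, from the nonnegativity of the form at [x - t *: y] for every [t]; when
    [bform A y y] is nonzero, [t] is taken at the minimum. *)
Lemma psd_bform_sqr_le A x y : psd A ->
  bform A x y ^+ 2 <= bform A x x * bform A y y.
Proof.
move=> [As Ap]; have Aq z : 0 <= bform A z z by exact: Ap.
have q t : 0 <= bform A x x - t * bform A x y *+ 2 + t ^+ 2 * bform A y y.
  rewrite (_ : _ + _ = bform A (x + - t *: y) (x + - t *: y)) //.
  by rewrite !(bformDl, bformDr, bformZl, bformZr) (bformC y x As); ring.
have [y0|yn0] := eqVneq (bform A y y) 0; last first.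
  have yp : 0 < bform A y y by rewrite lt_neqAle eq_sym yn0 Aq.
  rewrite -subr_ge0; have := mulr_ge0 (q (bform A x y / bform A y y)) (ltW yp).
  set u := (_ + _) * _; suff -> : u = bform A x x * bform A y y - bform A x y ^+ 2 by [].
  by rewrite /u; field.
rewrite y0 mulr0; have [->|xy0] := eqVneq (bform A x y) 0; first by rewrite expr0n.
(* With [bform A y y = 0] the quadratic is affine in [t]; this [t] would give it the value -1. *)
have := q ((bform A x x + 1) / (bform A x y *+ 2)); rewrite y0.
have -> : bform A x x -
  (bform A x x + 1) / (bform A x y *+ 2) * bform A x y *+ 2 +
  ((bform A x x + 1) / (bform A x y *+ 2)) ^+ 2 * 0 = -1.
  by field; rewrite ?xy0 ?pnatr_eq0.
by rewrite oppr_ge0 ler10.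
Qed.

Lemma psd_diag_ge0 A i : psd A -> 0 <= A i i.
Proof. by move=> [_ /(_ (delta_mx i ord0))]; rewrite -/(bform _ _ _) bform_delta. Qed.

Lemma psd_entry_sqr_le A i j : psd A -> A i j ^+ 2 <= A i i * A j j.
Proof.
by move=> /(psd_bform_sqr_le (delta_mx i ord0) (delta_mx j ord0)); rewrite !bform_delta.
Qed.

Lemma psd_diag0 A : psd A -> (forall i, A i i = 0) -> A = 0.
Proof.
move=> Ap A0; apply/matrixP => i j; rewrite mxE.
have := psd_entry_sqr_le i j Ap; rewrite A0 mul0r => h.
by apply/eqP; rewrite -sqrf_eq0 eq_le h sqr_ge0.
Qed.

Definition schur_complement A k := A - (A k k)^-1 *: (col k A *m row k A).

(** The form of the Schur complement at [x] is [bform A x x] minus the square of [bform A x e_k]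
    divided by [A k k], so this is Cauchy-Schwarz for [x] and [e_k]. *)
Lemma psd_schur_complement A k : psd A -> 0 < A k k -> psd (schur_complement A k).
Proof.
move=> Ap kp; have [As _] := Ap.
have rk : row k A = (col k A)^T by rewrite tr_col As.
split=> [|x].
  by rewrite /schur_complement linearB linearZ /= trmx_mul As rk trmxK.
rewrite -/(bform _ x x) /schur_complement -scaleNr bformD bformZ.
have -> : bform (col k A *m row k A) x x = bform A x (delta_mx k ord0) ^+ 2.
  rewrite /bform mulmxA -mulmxA mxE big_ord1 expr2; congr (_ * _).
    by rewrite colE mulmxA.
  by rewrite rk colE trmx_mul As -[LHS](bformC _ _ As).
have := psd_bform_sqr_le x (delta_mx k ord0) Ap; rewrite bform_delta => h.
by rewrite mulNr subr_ge0 ler_pdivrMl // [leRHS]mulrC.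
Qed.

(** The inclusion is strict because [e_k] is killed by the Schur complement but not by [A]. *)
Lemma schur_complement_ltmx A k : A k k != 0 -> A^T = A ->
  (schur_complement A k < A)%MS.
Proof.
move=> k0 As; rewrite ltmxE; apply/andP; split.
  rewrite /schur_complement rowE scalemxAl mulmxA -{1}[A]mul1mx -mulmxBl; exact: submxMl.
apply/negP => /submxP[D AD].
have : A *m delta_mx k ord0 = 0 :> 'cV[R]_d.
  rewrite AD -mulmxA /schur_complement mulmxBl -scalemxAl -mulmxA.
  have -> : row k A *m delta_mx k ord0 = (A k k)%:M :> 'M[R]_(1,1).
    by apply/matrixP => i j; rewrite !ord1 [RHS]mxE -(bform_delta A k k) /bform trmx_delta -rowE.
  by rewrite mul_mx_scalar scalerA mulVf // scale1r colE subrr mulmx0.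
rewrite -colE => /matrixP/(_ k ord0); rewrite !mxE => /eqP; exact/negP.
Qed.

(** Cholesky factorisation by induction on [r]: a nonzero pivot contributes one column of [V], and
    the Schur complement that remains has smaller rank. *)
Lemma psd_factor r A : psd A -> (\rank A <= r)%N ->
  exists V : 'M[R]_(d, r), A = V *m V^T.
Proof.
elim: r A => [|r IHr] A Ap rA.
  by exists 0; rewrite mul0mx; apply/eqP; rewrite -mxrank_eq0 -leqn0.
have [/forallP A0|] := boolP [forall k, A k k == 0].
  exists 0; rewrite mul0mx; apply: psd_diag0 => // i; exact/eqP.
rewrite negb_forall => /existsP[k kn0].
have kp : 0 < A k k by rewrite lt_neqAle eq_sym kn0 psd_diag_ge0.
have [As _] := Ap.
have [|V VV] := IHr _ (psd_schur_complement Ap kp).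
  by rewrite -ltnS (leq_trans _ rA) // rank_ltmx // schur_complement_ltmx.
exists (row_mx (Num.sqrt (A k k)^-1 *: col k A) V : 'M[R]_(d, 1 + r)).
suff : A = row_mx (Num.sqrt (A k k)^-1 *: col k A) V *m
  (row_mx (Num.sqrt (A k k)^-1 *: col k A) V)^T by [].
rewrite tr_row_mx mul_row_col -VV linearZ /= -scalemxAl -scalemxAr scalerA.
rewrite -expr2 sqr_sqrtr ?invr_ge0 ?psd_diag_ge0 // tr_col As.
by rewrite /schur_complement addrC subrK.
Qed.

(** Each entry of [A *m x] is the form evaluated at a basis vector and [x]; Cauchy-Schwarz is summed
    over the basis vectors. *)
Lemma psd_mul_sqr_le A x : psd A ->
  \sum_i (A *m x) i ord0 ^+ 2 <= \tr A * bform A x x.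
Proof.
move=> Ap; rewrite /mxtrace mulr_suml; apply: ler_sum => i _.
have -> : (A *m x) i ord0 = bform A (delta_mx i ord0) x.
  by rewrite /bform trmx_delta -rowE -row_mul [RHS]mxE.
by rewrite -(bform_delta A i i) psd_bform_sqr_le.
Qed.

Lemma bform_norm_le (C : 'M[R]_d) x :
  `|bform C x x| <= (\sum_i \sum_j `|C i j|) * \sum_i x i ord0 ^+ 2.
Proof.
rewrite bformE mulr_suml (le_trans (ler_norm_sum _ _ _)) //.
apply: ler_sum => i _; rewrite mulr_suml (le_trans (ler_norm_sum _ _ _)) //.
apply: ler_sum => j _; rewrite mulrAC mulrC normrM ler_wpM2l //.
have le k : x k ord0 ^+ 2 <= \sum_i x i ord0 ^+ 2.
  by rewrite (bigD1 k) //= lerDl sumr_ge0 // => l _; exact: sqr_ge0.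
have := le i; have := le j; rewrite normrM -(real_normK (num_real (x j ord0))).
rewrite -(real_normK (num_real (x i ord0))).
have := sqr_ge0 (`|x i ord0| - `|x j ord0|); nra.
Qed.

(** By symmetry and the inclusion of row spaces, [B = A *m C *m A]. Hence the form of [B] at [x] is
    bounded by a multiple of the squared norm of [A *m x], and so by [M * bform A x x]. A step of
    size [1 / (1 + M)] is then harmless. *)
Lemma psd_perturbation A B : psd A -> B^T = B -> (B <= A)%MS ->
  exists2 e : R, 0 < e & psd (A + e *: B).
Proof.
move=> Ap Bs BA; have [As Aq] := Ap.
set C := (B *m pinvmx A)^T *m pinvmx A.
have BE : B = A *m C *m A.
  have AP : A *m (B *m pinvmx A)^T = B.
    by rewrite -[in LHS]As -trmx_mul As mulmxKpV.
  by rewrite /C mulmxA AP mulmxKpV.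
have bE x : bform B x x = bform C (A *m x) (A *m x).
  by rewrite /bform trmx_mul As {1}BE !mulmxA.
set M := (\sum_i \sum_j `|C i j|) * \tr A.
have S0 : 0 <= \sum_i \sum_j `|C i j|.
  by apply: sumr_ge0 => i _; apply: sumr_ge0.
have M0 : 0 <= M.
  by rewrite mulr_ge0 // sumr_ge0 // => i _; exact: psd_diag_ge0.
have e0 : 0 < (1 + M)^-1 by rewrite invr_gt0 ltr_wpDr.
exists (1 + M)^-1 => //; split=> [|x].
  by rewrite linearD linearZ /= As Bs.
rewrite -/(bform _ x x) bformD bformZ.
have q0 : 0 <= bform A x x by exact: Aq.
have bx : `|bform B x x| <= M * bform A x x.
  rewrite bE (le_trans (bform_norm_le _ _)) // /M -mulrA ler_wpM2l //.
  exact: psd_mul_sqr_le.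
rewrite -(pmulr_rge0 _ (_ : 0 < 1 + M)) ?ltr_wpDr // mulrDr mulrA mulfV ?mul1r; last first.
  by rewrite gt_eqF // ltr_wpDr.
by move: bx; rewrite ler_norml; nra.
Qed.

End PositiveSemidefinite.

(** * Faces of the elliptope and reduction to rank at most 2 *)

Section RankReduction.
Variables (R : realType) (d : nat).
Implicit Types (A B : 'M[R]_d).

(* [6 = dim Sym_3 > d]: the [d] diagonal entries of [W^T S W] cannot separate
   the symmetric [3 x 3] matrices [S]. *)
Lemma symmetric_zero_diag_exists A : (d <= 5)%N -> (3 <= \rank A)%N ->
  exists B, [/\ B != 0, B^T = B, (B <= A)%MS & forall i, B i i = 0].
Proof.
move=> d5 r3.
have [W Wfree WA] : exists2 W : 'M[R]_(3, d), row_free W & (W <= A)%MS.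
  exists (pid_mx 3 *m row_base A).
    by rewrite /row_free mxrankMfree ?row_base_free // rank_pid_mx.
  by rewrite (submx_trans (submxMl _ _)) // eq_row_base.
(* Unordered pairs are numbered along the rows of the lower triangle: row [m] starts at
   [m (m + 1) / 2]. *)
pose idx (a b : 'I_3) : 'I_6 := inord ('C((maxn a b).+1, 2) + minn a b).
have idxC a b : idx a b = idx b a by rewrite /idx maxnC minnC.
have idxE (a b : 'I_3) : idx a b = ('C((maxn a b).+1, 2) + minn a b)%N :> nat.
  by rewrite inordK //; case: a b => [[|[|[|a]]] ?] [[|[|[|b]]] ?].
have idx_surj k : exists a b, idx a b = k.
  pose s : seq ('I_3 * 'I_3) := [:: (inord 0, inord 0); (inord 0, inord 1);
    (inord 1, inord 1); (inord 0, inord 2); (inord 1, inord 2); (inord 2, inord 2)].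
  exists (nth (ord0, ord0) s k).1, (nth (ord0, ord0) s k).2; apply: val_inj => /=.
  by rewrite idxE; case: k => [[|[|[|[|[|[|k]]]]]] ?] //=; rewrite !inordK.
(* [M] sends the six free entries of a symmetric [S] to the diagonal of [W^T *m S *m W]. It has 6
   rows and at most 5 columns, so its left kernel is nonzero. *)
pose M : 'M[R]_(6, d) := \matrix_(k, i)
  \sum_(ab : 'I_3 * 'I_3 | idx ab.1 ab.2 == k) W ab.1 i * W ab.2 i.
have /rowV0Pn[v /sub_kermxP vM v0] : kermx M != 0.
  rewrite -mxrank_eq0 mxrank_ker subn_eq0 -ltnNge ltnS.
  by rewrite (leq_trans (rank_leq_col _)).
pose S : 'M[R]_3 := \matrix_(a, b) v ord0 (idx a b).
have Ss : S^T = S by apply/matrixP => a b; rewrite !mxE idxC.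
have S0 : S != 0.
  apply: contra_neq v0 => S0; apply/rowP => k; have [a [b <-]] := idx_surj k.
  by move/matrixP: S0 => /(_ a b); rewrite !mxE.
(* The right inverse [X] of [W] recovers [S] from [W^T *m S *m W], which is therefore nonzero. *)
have [X WX] := row_freeP Wfree.
exists (W^T *m S *m W); split.
- apply: contra_neq S0 => B0.
  have : X^T *m (W^T *m S *m W) *m X = S.
    by rewrite !mulmxA -trmx_mul WX trmx1 mul1mx -mulmxA WX mulmx1.
  by rewrite B0 mulmx0 mul0mx => <-.
- by rewrite !trmx_mul trmxK Ss mulmxA.
- by rewrite (submx_trans (submxMl _ _)).
- move=> i; move/rowP/(_ i) : vM; rewrite [RHS]mxE => <-.
  rewrite [LHS]mxE.
  transitivity (\sum_(ab : 'I_3 * 'I_3) v ord0 (idx ab.1 ab.2) * (W ab.1 i * W ab.2 i)).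
    rewrite (eq_bigr (fun b => \sum_a v ord0 (idx a b) * (W a i * W b i))); last first.
      by move=> b _; rewrite mxE mulr_suml; apply: eq_bigr => a _; rewrite !mxE; ring.
    by rewrite exchange_big pair_big.
  rewrite (partition_big (fun ab => idx ab.1 ab.2) xpredT) //= mxE.
  apply: eq_bigr => k _; rewrite mxE mulr_sumr.
  by apply: eq_bigr => ab /eqP ->.
Qed.

Lemma correlation_entry_norm_le1 A i j :
  correlation_matrices R d A -> `|A i j| <= 1.
Proof.
move=> [Ap A1]; have := psd_entry_sqr_le i j Ap; rewrite !A1 mulr1.
by rewrite -real_normK ?num_real // expr_le1.
Qed.

(** The zero diagonal of [B] preserves the unit diagonal, and bounded entries make the admissible
    [t] bounded. At their supremum the rank must have dropped: otherwise [B] would still lie in the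
    row space and a further perturbation would be possible. *)
Lemma correlation_rank_drop A B :
  correlation_matrices R d A -> B != 0 -> B^T = B -> (B <= A)%MS ->
  (forall i, B i i = 0) ->
  exists2 t : R, 0 < t & correlation_matrices R d (A + t *: B) /\
    (\rank (A + t *: B)%R < \rank A)%N.
Proof.
move=> AP B0 Bs BA Bd; have [Ap A1] := AP; have [As Aq] := Ap.
have AtP t : psd (A + t *: B) -> correlation_matrices R d (A + t *: B).
  by move=> h; split => // i; rewrite !mxE Bd mulr0 addr0.
have AtA t : ((A + t *: B)%R <= A)%MS by rewrite addmx_sub // scalemx_sub.
pose T : set R := [set t | 0 <= t /\ psd (A + t *: B)].
have [i [j Bij]] : exists i j, B i j != 0.
  apply: contraPP B0 => /forallNP h; apply/negP/negPn/eqP/matrixP => i j.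
  by rewrite mxE; apply/eqP/negPn/negP => hij; apply: (h i); exists j.
have supT : has_sup T.
  split; first by exists 0; split => //; rewrite scale0r addr0.
  exists (2 / `|B i j|) => t [t0 /AtP].
  move=> /(correlation_entry_norm_le1 i j); rewrite !mxE => h.
  rewrite ler_pdivlMr ?normr_gt0 // -[t in t * _]ger0_norm // -normrM.
  rewrite -(addKr (A i j) (t * B i j)) (le_trans (ler_normD _ _)) // normrN.
  by have := correlation_entry_norm_le1 i j AP; lra.
set t := sup T.
have tub s : T s -> s <= t by move=> Ts; exact: sup_upper_bound supT _ Ts.
have [e e0 Ae] := psd_perturbation Ap Bs BA.
have t0 : 0 < t by rewrite (lt_le_trans e0) // tub //; split=> //; exact: ltW.
have Tt : psd (A + t *: B).
  (* The supremum is itself admissible: a negative value of the form at [x] forces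
     [bform B x x < 0], and then every admissible [s] is at most [bform A x x / - bform B x x],
     which would be less than [t]. *)
  split=> [|x]; first by rewrite linearD linearZ /= As Bs.
  rewrite -/(bform _ x x) bformD bformZ leNgt; apply/negP => tlt.
  have qA : 0 <= bform A x x by exact: Aq.
  have qB : bform B x x < 0.
    by rewrite ltNge; apply/negP => qB; have := mulr_ge0 (ltW t0) qB; lra.
  suff : t <= bform A x x / - bform B x x.
    by rewrite ler_pdivlMr ?oppr_gt0 //; lra.
  apply: ge_sup => [|s [s0 [_ /(_ x)]]]; first by case: supT.
  rewrite -/(bform _ x x) bformD bformZ ler_pdivlMr ?oppr_gt0 //; lra.
exists t => //; split; first exact: AtP.
rewrite ltnNge; apply/negP => rle.
have AAt : (A <= (A + t *: B)%R)%MS by rewrite -(geq_leqif (mxrank_leqif_sup (AtA t))).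
have [f f0 Af] := psd_perturbation Tt Bs (submx_trans BA AAt).
have : t + f <= t.
  by apply: tub; split; [rewrite addr_ge0 // ltW | rewrite scalerDl addrA].
by rewrite gerDl leNgt f0.
Qed.

(* Minkowski's theorem for the elliptope: for [d <= 5] its extreme points have
   rank at most 2. *)
Lemma correlation_matrices_ind (Q : 'M[R]_d -> Prop) : (d <= 5)%N ->
  (forall A, correlation_matrices R d A -> (\rank A <= 2)%N -> Q A) ->
  (forall A B p, 0 <= p <= 1 -> Q A -> Q B -> Q (p *: A + (1 - p) *: B)) ->
  forall A, correlation_matrices R d A -> Q A.
Proof.
move=> d5 Q2 Qconv A; have [n] := ubnP (\rank A).
elim: n A => // n IH A rA AP.
have [r2|r3] := leqP (\rank A) 2; first exact: Q2.
have [B [B0 Bs BA Bd]] := symmetric_zero_diag_exists d5 r3.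
have [t t0 [tP tr]] := correlation_rank_drop AP B0 Bs BA Bd.
have [s s0 [sP sr]] : exists2 s : R, 0 < s &
    correlation_matrices R d (A + s *: - B) /\ (\rank (A + s *: - B)%R < \rank A)%N.
  apply: correlation_rank_drop => //.
  - by rewrite oppr_eq0.
  - by rewrite linearN /= Bs.
  - by rewrite eqmx_opp.
  - by move=> i; rewrite mxE Bd oppr0.
(* The weights are inversely proportional to the distances [t] and [s] travelled, so the multiples
   of [B] cancel. *)
have -> : A = (s / (s + t)) *: (A + t *: B) + (1 - s / (s + t)) *: (A + s *: - B).
  apply/matrixP => i j; rewrite !mxE; field; rewrite gt_eqF //; lra.
apply: Qconv.
- by rewrite divr_ge0 ?ler_pdivrMr ?mul1r ?addr_gt0 ?lerDl //; lra.
- by apply: IH tP; exact: leq_trans tr _.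
- by apply: IH sP; exact: leq_trans sr _.
Qed.

End RankReduction.

(** * Angles of the rows of a rank 2 factor *)

Lemma unit_circle_angle (R : realType) (x y : R) : x ^+ 2 + y ^+ 2 = 1 ->
  exists2 t : R, 0 <= t <= 2 * pi & x = cos t /\ y = sin t.
Proof.
move=> xy1; have xI : -1 <= x <= 1 by have := sqr_ge0 y; nra.
have sE : sin (acos x) = `|y|.
  by rewrite sin_acos // -xy1 addrC addKr sqrtr_sqr.
have a0 := acos_ge0 xI; have api := acos_lepi xI; have p0 := pi_ge0 R.
have [y0|y0] := leP 0 y.
  exists (acos x); first by apply/andP; split; lra.
  by rewrite acosK ?in_itv // sE ger0_norm.
exists (2 * pi - acos x); first by apply/andP; split; lra.
rewrite mulrC mulr_natr cosB sinB cos2pi sin2pi sE acosK ?in_itv //.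
by rewrite ltr0_norm //; split; ring.
Qed.

(** In [A = V *m V^T] with two columns, the unit diagonal puts each row of [V] on the unit
    circle. *)
Lemma correlation_rank2_angles (R : realType) d (A : 'M[R]_d) :
  correlation_matrices R d A -> (\rank A <= 2)%N ->
  exists2 t : 'I_d -> R, forall i, 0 <= t i <= 2 * pi &
    forall i j, A i j = cos (t i - t j).
Proof.
move=> [Ap A1] /(psd_factor Ap)[V AV].
have AE i j : A i j = V i ord0 * V j ord0 + V i ord_max * V j ord_max.
  by rewrite AV mxE !big_ord_recl big_ord0 addr0 !mxE; congr (_ + V i _ * V j _); apply: val_inj.
have h i : exists t : R, 0 <= t <= 2 * pi /\
    (V i ord0 = cos t /\ V i ord_max = sin t).
  have [|t] := @unit_circle_angle R (V i ord0) (V i ord_max); last by exists t.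
  by rewrite !expr2 -AE A1.
have [t tP] := choice h; exists t => [i|i j]; first by case: (tP i).
by rewrite AE cosB; have [_ [-> ->]] := tP i; have [_ [-> ->]] := tP j.
Qed.

(** * Invariance of the arcsine law under a shift of the angle *)

Section ArcsineShift.
Variable R : realType.
Notation mu := (@lebesgue_measure R).

(** The pushforward by a translation gives every half-open interval its length, which characterises
    Lebesgue measure. *)
Lemma lebesgue_measure_shift (a : R) (A : set (measurableTypeR R)) : measurable A ->
  mu ((fun x => x + a) @^-1` A) = mu A.
Proof.
have mf : measurable_fun [set: measurableTypeR R] (fun x : measurableTypeR R => x + a).
  exact: measurable_funD.
move=> mA; apply/esym; rewrite -[RHS]/(pushforward mu (fun x : measurableTypeR R => x + a : measurableTypeR R) A).
apply: lebesgue_measure_unique => //.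
move=> X [[b c] _ <-] /=; rewrite /pushforward.
have -> : (fun x : R => x + a) @^-1` `]b, c] = `]b - a, c - a]%classic.
  by apply/seteqP; split => x /=; rewrite !in_itv /= ltrBlDr lerBrDr.
rewrite !lebesgue_measure_itv /= !lte_fin ltrD2r; case: ifPn => // _.
by rewrite -!EFinB; congr (_%:E); lra.
Qed.

(** Translation moves the window to [[a, p + a[]. Its part beyond [p], moved back by one period,
    fills the missing [[0, a[]. *)
Lemma lebesgue_measure_periodic (p a : R) (E : set (measurableTypeR R)) :
  0 <= a <= p -> measurable E -> (forall t, E (t + p) <-> E t) ->
  mu ((fun x => x + a) @^-1` E `&` `[0, p[) = mu (E `&` `[0, p[).
Proof.
move=> /andP[a0 ap] mE Ep.
have mI b c : measurable (E `&` `[b, c[) by exact: measurableI.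
have split b c e : b <= c <= e ->
    mu (E `&` `[b, e[) = (mu (E `&` `[b, c[) + mu (E `&` `[c, e[))%E.
  move=> /andP[bc ce]; rewrite -measureU //.
    rewrite -setIUr; congr (mu (_ `&` _)); apply/seteqP; split => x /=; rewrite !in_itv /=.
      by have [xc|xc] := ltP x c => /andP[? ?]; [left|right]; apply/andP; split; lra.
    by case=> /andP[? ?]; apply/andP; split; lra.
  apply/seteqP; split => x //= [[_]]; rewrite !in_itv /= => /andP[? ?] [_] /andP[? ?].
  by exfalso; lra.
have -> : (fun x => x + a) @^-1` E `&` `[0, p[ = (fun x => x + a) @^-1` (E `&` `[a, p + a[).
  apply/seteqP; split => x /=; rewrite !in_itv /= => -[? /andP[? ?]]; split => //.
    by apply/andP; split; lra.
  by apply/andP; split; lra.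
rewrite lebesgue_measure_shift // (split a p) ?(split 0 a p); last 2 first.
- by rewrite a0.
- by rewrite ap lerDl.
rewrite addeC; congr (_ + _)%E.
rewrite -(lebesgue_measure_shift p) //; congr (mu _).
apply/seteqP; split => x /=; rewrite !in_itv /= => -[/Ep ? /andP[? ?]]; split => //.
  by apply/andP; split; lra.
by apply/andP; split; lra.
Qed.

(** The null endpoint [b] is dropped because half-open windows can be cut and translated without
    overlap. *)
Lemma uniform_prob_set (a b : R) (ab : a < b) (U : set (measurableTypeR R)) :
  measurable U ->
  uniform_prob ab U = ((b - a)^-1%:E * mu (U `&` `[a, b[))%E.
Proof.
move=> mU; rewrite /uniform_prob integral_uniform_pdf.
have mUab : measurable (U `&` `[a, b[) by exact: measurableI.
have mUb : measurable (U `&` [set b]) by exact: measurableI.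
rewrite (eq_integral (fun=> (b - a)^-1%:E)); last first.
  by move=> x; rewrite inE /= in_itv /= /uniform_pdf => -[_ ->].
rewrite integral_cst //=; last exact: measurableI.
have -> : U `&` `[a, b] = (U `&` `[a, b[) `|` (U `&` [set b]).
  by rewrite -setIUr -(setUitv1 true) // bnd_simp ltW.
rewrite measureU //; last first.
  apply/seteqP; split => x //= [[_]]; rewrite in_itv /= => /andP[_ xb] [_ xeb].
  by move: xb; rewrite xeb ltxx.
congr (_ * _)%E; rewrite -[RHS]adde0; congr (_ + _)%E.
by apply/eqP; rewrite eq_le measure_ge0 andbT -(lebesgue_measure_set1 b) le_measure ?inE.
Qed.

Definition shifted_sqrt2_cos (a : R) (t : measurableTypeR R) : R := sqrt2_cos (t + a).

Lemma measurable_shifted_sqrt2_cos a :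
  measurable_fun [set: measurableTypeR R] (shifted_sqrt2_cos a).
Proof.
apply: (measurableT_comp (@measurable_sqrt2_cos R)).
exact: measurable_funD.
Qed.

HB.instance Definition _ a :=
  isMeasurableFun.Build _ _ _ _ (shifted_sqrt2_cos a) (@measurable_shifted_sqrt2_cos a).

Lemma shifted_sqrt2_cos_law (a : R) : 0 <= a <= 2 * pi ->
  has_law (P := uniform_prob (two_pi_gt0 R)) (shifted_sqrt2_cos a) (arcsine_law R).
Proof.
move=> a02 A mA.
rewrite -[LHS]/(uniform_prob (two_pi_gt0 R) (shifted_sqrt2_cos a @^-1` A)).
rewrite -[RHS]/(uniform_prob (two_pi_gt0 R) (@sqrt2_cos R @^-1` A)).
have mE : measurable (@sqrt2_cos R @^-1` A).
  by rewrite -[X in measurable X]setTI; exact: measurable_sqrt2_cos.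
have mU : measurable (shifted_sqrt2_cos a @^-1` A).
  by rewrite -[X in measurable X]setTI; exact: measurable_shifted_sqrt2_cos.
rewrite !uniform_prob_set //; congr (_ * _)%E.
apply: (@lebesgue_measure_periodic (2 * pi) a (@sqrt2_cos R @^-1` A)) => // t /=.
by rewrite /sqrt2_cos (mulrC 2) mulr_natr cosD2pi.
Qed.

End ArcsineShift.

(** * Moments of shifted cosines by explicit antiderivatives *)

Section UniformIntegral.
Variable R : realType.
Notation P0 := (uniform_prob (two_pi_gt0 R)).

Lemma uniform_bounded_integrable (f : R -> R) (M : R) :
  continuous f -> (forall x, `|f x| <= M) ->
  P0.-integrable [set: measurableTypeR R] (EFin \o f).
Proof.
move=> cf fM; apply: measurable_bounded_integrable => //.
- by rewrite [X in (X < _)%E]probability_setT ltry.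
- exact: continuous_measurable_fun.
- by exists M; split; [rewrite num_real|move=> N MN x _ /=; rewrite (le_trans (fM x)) // ltW].
Qed.

Lemma uniform_integral_derive (f F : R -> R) (M : R) :
  continuous f -> (forall x, `|f x| <= M) ->
  (forall x : R, is_derive x 1 F (f x)) ->
  \int[P0]_x f x = (F (2 * pi) - F 0) / (2 * pi).
Proof.
move=> cf fM dF.
have p0 := two_pi_gt0 R.
(* The integral formula for the uniform law is applied to the nonnegative function [f + M], with
   antiderivative [G]; the constant is subtracted at the end. *)
pose G x := F x + M * x.
have dG (x : R) : is_derive x 1 G (f x + M).
  have -> : f x + M = f x + M *: 1 by rewrite scaler1.
  rewrite /G; apply: is_deriveD.
have cG : continuous G.
  move=> x; apply: differentiable_continuous; apply/derivable1_diffP.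
  by have := dG x.
have g0 x : 0 <= f x + M by have := fM x; rewrite ler_norml => /andP[? _]; lra.
have cg : continuous (fun x => f x + M).
  by move=> x; apply: cvgD; [exact: cf|exact: cvg_cst].
have E : (\int[P0]_x (f x + M)%:E = ((2 * pi)^-1 * (G (2 * pi) - G 0))%:E)%E.
  rewrite integral_uniform; last 2 first.
  - by apply/measurable_EFinP; exact: continuous_measurable_fun.
  - by move=> x; rewrite lee_fin.
  rewrite (@continuous_FTC2 _ _ G) //.
  - by rewrite subr0 -EFinB -EFinM.
  - exact: continuous_subspaceT.
  - split.
    + by move=> x _; have [] := dG x.
    + by apply: cvg_at_right_filter; exact: cG.
    + by apply: cvg_at_left_filter; exact: cG.
  - by move=> x _; rewrite derive1E; have := dG x => dGx; rewrite derive_val.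
have If := uniform_bounded_integrable cf fM.
have : \int[P0]_x (f x + M) = (2 * pi)^-1 * (G (2 * pi) - G 0) by rewrite /Rintegral E.
rewrite RintegralD //; last exact: finite_measure_integrable_cst.
rewrite Rintegral_cst // [X in fine X]probability_setT mulr1 /G => h.
have -> : \int[P0]_x f x =
  (2 * pi)^-1 * (F (2 * pi) + M * (2 * pi) - (F 0 + M * 0)) - M by rewrite -h addrK.
have pn0 : pi != 0 :> R by rewrite gt_eqF ?pi_gt0.
move: (pi : R) pn0 => p pn0; field; exact: pn0.
Qed.

Lemma cosBE (t a b : R) :
  cos (a - b) = cos (t + a) * cos (t + b) + sin (t + a) * sin (t + b).
Proof. by rewrite -cosB; congr cos; ring. Qed.

Lemma continuous_cos_shift (a : R) : continuous (fun t : R => cos (t + a)).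
Proof.
move=> t; apply: (@continuous_comp _ _ _ (fun t => t + a) cos); last exact: continuous_cos.
by apply: cvgD; [exact: cvg_id|exact: cvg_cst].
Qed.

Lemma is_derive_cos_shift (a x : R) :
  is_derive x 1 (fun t => cos (t + a)) (- sin (x + a)).
Proof.
have h := is_derive_shift x (1 : R) a.
by have := @is_derive1_comp R cos (shift a) x _ _ (is_derive_cos (x + a)) h; rewrite mulr1.
Qed.

Lemma is_derive_sin_shift (a x : R) :
  is_derive x 1 (fun t => sin (t + a)) (cos (x + a)).
Proof.
have h := is_derive_shift x (1 : R) a.
by have := @is_derive1_comp R sin (shift a) x _ _ (is_derive_sin (x + a)) h; rewrite mulr1.
Qed.

Notation X := (@shifted_sqrt2_cos R).

Lemma shifted_sqrt2_cos_continuous a : continuous (X a).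
Proof.
move=> t; apply: cvgM; first exact: cvg_cst.
exact: continuous_cos_shift.
Qed.

Lemma shifted_sqrt2_cos_bounded a t : `|X a t| <= Num.sqrt 2.
Proof.
rewrite /shifted_sqrt2_cos /sqrt2_cos normrM ger0_norm ?sqrtr_ge0 //.
by rewrite ler_piMr ?sqrtr_ge0 ?cos_max.
Qed.

Lemma shifted_sqrt2_cos_mean a :
  P0.-integrable [set: measurableTypeR R] (EFin \o X a) /\ \int[P0]_x X a x = 0.
Proof.
have cX := @shifted_sqrt2_cos_continuous a; have bX := @shifted_sqrt2_cos_bounded a.
split; first exact: uniform_bounded_integrable cX bX.
have dF (x : R) : is_derive x 1 (fun t => Num.sqrt 2 * sin (t + a)) (X a x).
  have h := is_derive_sin_shift a x.
  by have := is_deriveZ (Num.sqrt 2) h.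
rewrite (uniform_integral_derive cX bX dF).
by rewrite add0r (addrC _ a) (mulrC 2) mulr_natr sinD2pi subrr mul0r.
Qed.

Lemma shifted_sqrt2_cos_covariance a b :
  P0.-integrable [set: measurableTypeR R] (EFin \o (fun t => X a t * X b t)) /\
  \int[P0]_x (X a x * X b x) = cos (a - b).
Proof.
have cX : continuous (fun t => X a t * X b t).
  by move=> t; apply: cvgM; exact: shifted_sqrt2_cos_continuous.
have bX t : `|X a t * X b t| <= Num.sqrt 2 * Num.sqrt 2.
  by rewrite normrM ler_pM ?shifted_sqrt2_cos_bounded.
split; first exact: uniform_bounded_integrable cX bX.
(* By [cosBE] the derivative is [2 cos (x + a) cos (x + b)]. Over a full period only the linear term
   contributes, as also for the fourth moment. *)
have dF (x : R) : is_derive x 1 (fun t => cos (a - b) * t + sin (t + a) * cos (t + b))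
    (X a x * X b x).
  have h1 := is_derive_sin_shift a x; have h2 := is_derive_cos_shift b x.
  have h3 := is_deriveM h1 h2.
  have h4 := is_deriveZ (cos (a - b)) (is_derive_id x (1 : R)).
  apply: is_derive_eq (is_deriveD h4 h3) _.
  rewrite /GRing.scale /= (cosBE x) /shifted_sqrt2_cos /sqrt2_cos.
  set s := Num.sqrt 2; have ss : s ^+ 2 = 2 by rewrite sqr_sqrtr.
  rewrite [RHS](_ : _ = s ^+ 2 * (cos (x + a) * cos (x + b))); last by ring.
  by rewrite ss; ring.
rewrite (uniform_integral_derive cX bX dF).
have -> : 2 * pi = pi *+ 2 :> R by rewrite mulrC mulr_natr.
rewrite !add0r !(addrC (pi *+ 2)) sinD2pi cosD2pi.
have pn0 : pi *+ 2 != 0 :> R by rewrite mulrn_eq0 negb_or /= gt_eqF ?pi_gt0.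
by move: (pi *+ 2) pn0 => p pn0; field.
Qed.

Lemma shifted_sqrt2_cos_moment4 a :
  P0.-integrable [set: measurableTypeR R] (EFin \o (fun t => X a t ^+ 4)) /\
  \int[P0]_x (X a x ^+ 4) = 3 / 2.
Proof.
have cX : continuous (fun t => X a t ^+ 4).
  move=> t; apply: (@continuous_comp _ _ _ (X a) (fun x => x ^+ 4)).
    exact: shifted_sqrt2_cos_continuous.
  exact: exprn_continuous.
have bX t : `|X a t ^+ 4| <= Num.sqrt 2 ^+ 4.
  by rewrite normrX lerXn2r ?nnegrE ?sqrtr_ge0 ?shifted_sqrt2_cos_bounded.
split; first exact: uniform_bounded_integrable cX bX.
have dF (x : R) : is_derive x 1 (fun t => 3 / 2 * t + sin (t + a) *
   (3 / 2 * cos (t + a) + cos (t + a) ^+ 3))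
    (X a x ^+ 4).
  have h1 := is_derive_sin_shift a x; have h2 := is_derive_cos_shift a x.
  have h5 : is_derive x 1 (fun t : R => 3 / 2 * cos (t + a) + cos (t + a) ^+ 3) _ :=
    is_deriveD (is_deriveZ (3 / 2) h2) (is_deriveX 3 h2).
  have h3 := is_deriveM h1 h5.
  have h4 := is_deriveZ (3 / 2) (is_derive_id x (1 : R)).
  apply: is_derive_eq (is_deriveD h4 h3) _.
  rewrite /GRing.scale /= /shifted_sqrt2_cos /sqrt2_cos.
  set s := Num.sqrt 2; have ss : s ^+ 2 = 2 by rewrite sqr_sqrtr.
  rewrite exprMn (exprM s 2 2) ss.
  set c := cos _; set t := sin _; have tt : t ^+ 2 = 1 - c ^+ 2 by exact: sin2cos2.
  rewrite [LHS](_ : _ = 3 / 2 - (3 / 2 + 3 * c ^+ 2) * t ^+ 2 +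
    (3 / 2 + c ^+ 2) * c ^+ 2); last by ring.
  by rewrite tt; field.
rewrite (uniform_integral_derive cX bX dF).
have -> : 2 * pi = pi *+ 2 :> R by rewrite mulrC mulr_natr.
rewrite !add0r !(addrC (pi *+ 2)) sinD2pi cosD2pi.
have pn0 : pi *+ 2 != 0 :> R by rewrite mulrn_eq0 negb_or /= gt_eqF ?pi_gt0.
by move: (pi *+ 2) pn0 => p pn0; field.
Qed.

End UniformIntegral.

(** * Transfer of integrals between variables with the same law *)

Section SameLaw.
Context (R : realType) (disp disp' : measure_display)
  (T : measurableType disp) (T' : measurableType disp')
  (P : probability T R) (Q : probability T' R).
Variables (X : {RV P >-> R}) (Y : {RV Q >-> R}).
Hypothesis XY : forall A : set R, measurable A -> distribution P X A = distribution Q Y A.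

(** Both integrals are integrals of [g] against the common distribution; applied first to the
    absolute value, this also transfers integrability. *)
Lemma same_law_integral (g : R -> R) : measurable_fun [set: R] g ->
  Q.-integrable [set: T'] (EFin \o (fun t => g (Y t))) ->
  P.-integrable [set: T] (EFin \o (fun t => g (X t))) /\
  \int[P]_x g (X x) = \int[Q]_x g (Y x).
Proof.
move=> mg iY.
have mgE : measurable_fun [set: R] (EFin \o g) by exact/measurable_EFinP.
have iX : P.-integrable [set: T] (EFin \o (fun t => g (X t))).
  apply/integrableP; split.
    by apply/measurable_EFinP; exact: measurableT_comp.
  have -> : (\int[P]_x `|(EFin \o (fun t => g (X t))) x|)%E =
            (\int[Q]_x `|(EFin \o (fun t => g (Y t))) x|)%E.
    rewrite -[LHS](ge0_integral_distribution X (f := fun y => `|(EFin \o g) y|%E)) //; last first.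
      exact: measurableT_comp.
    rewrite -[RHS](ge0_integral_distribution Y (f := fun y => `|(EFin \o g) y|%E)) //; last first.
      exact: measurableT_comp.
    by apply: eq_measure_integral => A mA _; exact: XY.
  by move/integrableP : iY => [].
split => //; rewrite /Rintegral; congr fine.
rewrite -[LHS](integral_distribution (f := EFin \o g)) //.
rewrite -[RHS](integral_distribution (f := EFin \o g)) //.
by apply: eq_measure_integral => A mA _; exact: XY.
Qed.

End SameLaw.

(** * First, second and fourth moments of an arcsine variable *)

Section ArcsineMargin.
Context (R : realType) (disp : measure_display) (T : measurableType disp)
  (P : probability T R) (X : {RV P >-> R}).
Hypothesis XF : has_law X (arcsine_law R).

Let same_law (A : set R) : measurable A ->
  distribution P X A = distribution (uniform_prob (two_pi_gt0 R)) (@shifted_sqrt2_cos R 0) A.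
Proof.
move=> mA; rewrite XF // shifted_sqrt2_cos_law //.
by rewrite lexx mulr_ge0 // pi_ge0.
Qed.

Lemma arcsine_mean : P.-integrable [set: T] (EFin \o X) /\ \int[P]_x X x = 0.
Proof.
have [iY EY] := @shifted_sqrt2_cos_mean R 0.
have [||-> ->] := @same_law_integral _ _ _ _ _ _ _ _ _ same_law id => //.
Qed.

Lemma arcsine_moment2 :
  P.-integrable [set: T] (EFin \o (fun t => X t ^+ 2)) /\ \int[P]_x (X x ^+ 2) = 1.
Proof.
have [iY EY] := @shifted_sqrt2_cos_covariance R 0 0.
have [||-> ->] := @same_law_integral _ _ _ _ _ _ _ _ _ same_law (fun x => x ^+ 2) => //.
by split => //; move: EY; rewrite subrr cos0.
Qed.

Lemma arcsine_moment4 :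
  P.-integrable [set: T] (EFin \o (fun t => X t ^+ 4)) /\ \int[P]_x (X x ^+ 4) = 3 / 2.
Proof.
have [iY EY] := @shifted_sqrt2_cos_moment4 R 0.
by have [||-> ->] := @same_law_integral _ _ _ _ _ _ _ _ _ same_law (fun x => x ^+ 4).
Qed.

End ArcsineMargin.

(** * Correlations of a vector with arcsine margins *)

Section ArcsineVector.
Context (R : realType) (disp : measure_display) (T : measurableType disp)
  (P : probability T R) (d : nat) (X : 'I_d -> {RV P >-> R}).
Hypothesis XF : forall i, has_law (X i) (arcsine_law R).

(** The product is dominated by the sum of the two squares. *)
Lemma arcsine_product_integrable i j :
  P.-integrable [set: T] (EFin \o (fun t => X i t * X j t)).
Proof.
have [i2 _] := arcsine_moment2 (XF i); have [j2 _] := arcsine_moment2 (XF j).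
apply: (le_integrable measurableT _ _ (integrableD measurableT i2 j2)).
  by apply/measurable_EFinP; exact: measurable_funM.
move=> t _ /=; rewrite lee_fin normrM [leRHS]ger0_norm ?addr_ge0 ?sqr_ge0 //.
rewrite -(real_normK (num_real (X i t))) -(real_normK (num_real (X j t))).
have := sqr_ge0 (`|X i t| - `|X j t|); have := normr_ge0 (X i t); have := normr_ge0 (X j t).
nra.
Qed.

Lemma arcsine_covariance i j : covariance P (X i) (X j) = (\int[P]_x (X i x * X j x))%:E.
Proof.
have E0 k : 'E_P[X k]%E = 0%E.
  have [iX EX] := arcsine_mean (XF k); rewrite unlock.
  by rewrite -[LHS]fineK ?integrable_fin_num // [fine _]EX.
rewrite covariance.unlock !E0 /= unlock.
rewrite /Rintegral fineK ?integrable_fin_num ?arcsine_product_integrable //.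
apply: eq_integral => t _; by rewrite mulrfctE /= !subr0.
Qed.

Lemma arcsine_correlation i j : correlation (X i) (X j) = \int[P]_x (X i x * X j x).
Proof.
have V k : fine 'V_P[X k] = 1.
  rewrite /variance arcsine_covariance /= -[RHS](arcsine_moment2 (XF k)).2.
  by apply: eq_Rintegral => t _; rewrite expr2.
by rewrite /correlation !V sqrtr1 mulr1 divr1 arcsine_covariance.
Qed.

Lemma integrable_sum_fun (I : finType) (f : I -> T -> R) :
  (forall i, P.-integrable [set: T] (EFin \o f i)) ->
  P.-integrable [set: T] (EFin \o (fun t => \sum_i f i t)) /\
  \int[P]_x (\sum_i f i x) = \sum_i \int[P]_x f i x.
Proof.
move=> fi; suff h (r : seq I) : P.-integrable [set: T] (EFin \o (fun t => \sum_(i <- r) f i t)) /\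
  \int[P]_x (\sum_(i <- r) f i x) = \sum_(i <- r) \int[P]_x f i x by exact: h.
elim: r => [|i r [IH1 IH2]].
  have -> : (fun t => \sum_(i <- [::]) f i t) = fun=> 0.
    by apply/funext => t; rewrite big_nil.
  by rewrite big_nil; split; [exact: integrable0|rewrite Rintegral_cst // mul0r].
have -> : (fun t => \sum_(j <- i :: r) f j t) = (fun t => f i t + \sum_(j <- r) f j t).
  by apply/funext => t; rewrite big_cons.
split; first by have := integrableD measurableT (fi i) IH1; apply: eq_integrable.
by rewrite RintegralD // big_cons IH2.
Qed.

(** This makes correlation matrices semidefinite, and turns a kernel vector of the matrix into a
    linear combination with zero second moment. *)
Lemma arcsine_bform (v : 'cV[R]_d) :
  P.-integrable [set: T] (EFin \o (fun t => (\sum_i v i ord0 * X i t) ^+ 2)) /\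
  \int[P]_x ((\sum_i v i ord0 * X i x) ^+ 2) = bform (correlation_matrix X) v v.
Proof.
have E t : (\sum_i v i ord0 * X i t) ^+ 2 =
    \sum_(ij : 'I_d * 'I_d) v ij.1 ord0 * v ij.2 ord0 * (X ij.1 t * X ij.2 t).
  rewrite expr2 mulr_suml -(pair_big xpredT xpredT (fun i j =>
    v i ord0 * v j ord0 * (X i t * X j t))) /=.
  apply: eq_bigr => i _; rewrite mulr_sumr; apply: eq_bigr => j _; ring.
have iE (ij : 'I_d * 'I_d) : P.-integrable [set: T]
    (EFin \o (fun t => v ij.1 ord0 * v ij.2 ord0 * (X ij.1 t * X ij.2 t))).
  have := integrableZl measurableT (v ij.1 ord0 * v ij.2 ord0)
    (arcsine_product_integrable ij.1 ij.2).
  by apply: eq_integrable => // t _ /=; rewrite EFinM.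
have [i1 i2] := integrable_sum_fun iE.
rewrite (funext E); split => //; rewrite i2 bformE pair_big; apply: eq_bigr => ij _.
rewrite RintegralZl // ?arcsine_product_integrable // mxE arcsine_correlation; ring.
Qed.

Lemma arcsine_correlation_matrix : correlation_matrices R d (correlation_matrix X).
Proof.
split; last first.
  move=> i; rewrite mxE arcsine_correlation -[RHS](arcsine_moment2 (XF i)).2.
  by apply: eq_Rintegral => t _; rewrite expr2.
split=> [|v].
  apply/matrixP => i j; rewrite !mxE !arcsine_correlation.
  by apply: eq_Rintegral => t _; rewrite mulrC.
rewrite -[leRHS](arcsine_bform v).2; apply: Rintegral_ge0 => t _; exact: sqr_ge0.
Qed.

End ArcsineVector.

(** * Mixtures of two probability measures *)

Section Mixture.
Context (R : realType) (disp : measure_display) (T : measurableType disp)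
  (P1 P2 : probability T R) (p q : {nonneg R}).
Hypothesis pq : p%:num + q%:num = 1.

(** The equation on the weights is an argument so that the probability structure of [mixture pq] can
    be inferred. *)
Definition mixture of p%:num + q%:num = 1 :=
  measure_add (mscale p P1) (mscale q P2).

HB.instance Definition _ := Measure.copy (mixture pq)
  (measure_add (mscale p P1) (mscale q P2)).

Lemma mixture_setT : mixture pq setT = 1%E.
Proof.
rewrite /mixture measure_addE.
transitivity (p%:num%:E * P1 setT + q%:num%:E * P2 setT)%E; first by [].
by rewrite !probability_setT !mule1 -EFinD pq.
Qed.

HB.instance Definition _ := Measure_isProbability.Build _ _ _ (mixture pq) mixture_setT.

Lemma integral_mixture (f : T -> R) :
  P1.-integrable setT (EFin \o f) -> P2.-integrable setT (EFin \o f) ->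
  \int[mixture pq]_x f x = p%:num * \int[P1]_x f x + q%:num * \int[P2]_x f x.
Proof.
move=> i1 i2; have mf : measurable_fun setT (EFin \o f) by case/integrableP : i1.
have ge0 (g : T -> \bar R) : measurable_fun setT g -> (forall x, 0 <= g x)%E ->
    (\int[mixture pq]_x g x =
     p%:num%:E * \int[P1]_x g x + q%:num%:E * \int[P2]_x g x)%E.
  by move=> mg g0; rewrite ge0_integral_measure_add // !ge0_integral_mscale.
have fin (Q : probability T R) : Q.-integrable setT (EFin \o f) ->
    (\int[Q]_x (EFin \o f)^\+ x \is a fin_num)%E /\ (\int[Q]_x (EFin \o f)^\- x \is a fin_num)%E.
  by move=> iQ; rewrite !integrable_fin_num //; [exact: integrable_funeneg|exact: integrable_funepos].
have [p1 n1] := fin _ i1; have [p2 n2] := fin _ i2.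
rewrite /Rintegral integralE (integralE P1) (integralE P2) !ge0 //; last 2 first.
- exact: measurable_funeneg.
- exact: measurable_funepos.
(* Integrability makes the four positive and negative parts finite, leaving an identity between
   reals. *)
move: p1 n1 p2 n2; do 4 case: (integral _ _ _) => // ? _.
by rewrite /=; ring.
Qed.

End Mixture.

(** * Couplings transported to tuples *)

Section TupleSpace.
Context (R : realType) (d : nat).

(* Couplings living on different sample spaces can be mixed once they are
   transported to [R^d]. *)
Definition coord (i : 'I_d) (x : d.-tuple (measurableTypeR R)) : R := tnth x i.

Lemma measurable_coord i : measurable_fun setT (coord i).
Proof. exact: measurable_tnth. Qed.

HB.instance Definition _ i := isMeasurableFun.Build _ _ _ _ (coord i) (@measurable_coord i).

Context (disp : measure_display) (T : measurableType disp)
  (P : probability T R) (X : 'I_d -> {RV P >-> R}).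

Definition joint (t : T) : d.-tuple (measurableTypeR R) := [tuple X i t | i < d].

Lemma measurable_joint : measurable_fun setT joint.
Proof.
apply/measurable_fun_tnthP => i.
have -> : (@tnth d (measurableTypeR R) ^~ i) \o joint = (X i : T -> R) :> (T -> R).
  by apply: funext => t /=; rewrite tnth_mktuple.
by have := measurable_funPT (X i).
Qed.

HB.instance Definition _ := isMeasurableFun.Build _ _ _ _ joint measurable_joint.

End TupleSpace.

(** * Convexity of the attainable set, and attainability for [d <= 5] *)

Section ConvexMargin.
Context (R : realType) (d : nat).
Notation S := (margin_correlation_matrices (arcsine_law R) d).

(** Margins and correlations depend only on the joint law, so the coordinates under the pushforward
    by [joint X] do equally well. *)
Lemma margin_correlation_tuple A : S A ->
  exists P : probability (d.-tuple (measurableTypeR R)) R,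
    (forall i, has_law (P := P) (@coord R d i) (arcsine_law R)) /\
    A = correlation_matrix (P := P) (@coord R d).
Proof.
move=> [disp [T [P [X [XF ->]]]]].
pose Q : probability (d.-tuple (measurableTypeR R)) R := distribution P (joint X).
have cX i t : coord i (joint X t) = X i t by rewrite /coord tnth_mktuple.
have CF i : has_law (P := Q) (@coord R d i) (arcsine_law R).
  move=> C mC; rewrite -(XF i) //.
  rewrite -[LHS]/(P ((fun t => coord i (joint X t)) @^-1` C)).
  by rewrite (funext (cX i)).
exists Q; split=> //; apply/matrixP => i j; rewrite !mxE !arcsine_correlation //.
pose f (x : d.-tuple (measurableTypeR R)) : R := coord i x * coord j x.
have fE : (EFin \o f) \o joint X = EFin \o (fun t => X i t * X j t).
  by apply: funext => t; rewrite /= /f !cX.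
rewrite /Rintegral; congr fine.
rewrite -[RHS]/(\int[distribution P (joint X)]_x (EFin \o f) x)%E.
rewrite integral_distribution ?fE //.
- by apply/measurable_EFinP; exact: measurable_funM.
- exact: arcsine_product_integrable.
Qed.

(** Mixing two joint laws leaves the common margin unchanged. With standardised margins a
    correlation is a mixed second moment, hence affine in the joint law. *)
Lemma margin_correlation_convex A B p : 0 <= p <= 1 ->
  S A -> S B -> S (p *: A + (1 - p) *: B).
Proof.
move=> /andP[p0 p1] /margin_correlation_tuple[P1 [L1 ->]] /margin_correlation_tuple[P2 [L2 ->]].
have q0 : 0 <= 1 - p by rewrite subr_ge0.
have pq : (NngNum p0)%:num + (NngNum q0)%:num = 1 by rewrite /= addrC subrK.
have L i : has_law (P := mixture P1 P2 pq) (@coord R d i) (arcsine_law R).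
  move=> C mC.
  rewrite -[LHS]/(mixture P1 P2 pq (coord i @^-1` C)) /mixture measure_addE.
  transitivity (p%:E * distribution P1 (@coord R d i) C +
    (1 - p)%:E * distribution P2 (@coord R d i) C)%E; first by [].
  by rewrite L1 // L2 // -ge0_muleDl ?lee_fin // -EFinD addrC subrK mul1e.
exists _, _, (mixture P1 P2 pq), (@coord R d); split=> //.
apply/matrixP => i j; rewrite !mxE !arcsine_correlation // integral_mixture //.
- exact: arcsine_product_integrable L1 i j.
- exact: arcsine_product_integrable L2 i j.
Qed.

Lemma correlation_matrices_margin A : (d <= 5)%N -> correlation_matrices R d A -> S A.
Proof.
move=> d5; apply: correlation_matrices_ind A => // [A AP r2|A B p]; last first.
  exact: margin_correlation_convex.
have [t t02 AE] := correlation_rank2_angles AP r2.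
have L i := shifted_sqrt2_cos_law (t02 i).
exists _, _, (uniform_prob (two_pi_gt0 R)), (fun i => @shifted_sqrt2_cos R (t i)).
split=> //; apply/matrixP => i j; rewrite mxE /= (arcsine_correlation L) /=.
by rewrite (shifted_sqrt2_cos_covariance (t i) (t j)).2.
Qed.

End ConvexMargin.

(** * The icosahedral Gram matrix and its quartic identity *)

Lemma psd_gram (R : realType) d r (V : 'M[R]_(d, r)) : psd (V *m V^T).
Proof.
split=> [|v]; first by rewrite trmx_mul trmxK.
have -> : v^T *m (V *m V^T) *m v = (V^T *m v)^T *m (V^T *m v).
  by rewrite trmx_mul trmxK !mulmxA.
by rewrite mxE sumr_ge0 // => k _; rewrite mxE -expr2 sqr_ge0.
Qed.

Section Icosahedron.
Variable R : realType.

(* The golden ratio is [ico_b / ico_a], and [(0, ico_a, ico_b)] has norm 1. *)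
Definition ico_a : R := Num.sqrt ((1 - (Num.sqrt 5)^-1) / 2).
Definition ico_b : R := Num.sqrt ((1 + (Num.sqrt 5)^-1) / 2).

(** The value 1/5 of the product is what makes the sum of fourth powers over the axes a multiple of
    the squared norm squared. *)
Lemma ico_ab : [/\ ico_a ^+ 2 + ico_b ^+ 2 = 1, ico_a ^+ 2 * ico_b ^+ 2 = 1 / 5,
  ico_a != 0 & ico_b != 0].
Proof.
set r : R := (Num.sqrt 5)^-1.
have r2 : r ^+ 2 = 1 / 5 by rewrite /r exprVn sqr_sqrtr // mul1r.
have r0 : 0 <= r by rewrite invr_ge0 sqrtr_ge0.
have r1 : r <= 1 by rewrite -(@expr_le1 _ 2) // r2; lra.
have a2 : ico_a ^+ 2 = (1 - r) / 2 by rewrite /ico_a /ico_b -/r sqr_sqrtr; lra.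
have b2 : ico_b ^+ 2 = (1 + r) / 2 by rewrite /ico_a /ico_b -/r sqr_sqrtr; lra.
have ab : ico_a ^+ 2 * ico_b ^+ 2 = 1 / 5.
  rewrite a2 b2 [LHS](_ : _ = (1 - r ^+ 2) / 4); last by field.
  by rewrite r2; field.
split=> //.
- by rewrite a2 b2; field.
- by apply: contra_eq_neq ab => ->; rewrite expr0n mul0r eq_sym div1r invr_eq0 pnatr_eq0.
- by apply: contra_eq_neq ab => ->; rewrite expr0n mulr0 eq_sym div1r invr_eq0 pnatr_eq0.
Qed.

Definition ico_axes : seq (seq R) :=
  [:: [:: 0; ico_a; ico_b]; [:: 0; ico_a; - ico_b];
      [:: ico_b; 0; ico_a]; [:: - ico_b; 0; ico_a];
      [:: ico_a; ico_b; 0]; [:: ico_a; - ico_b; 0]].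

(* The six diagonals of a regular icosahedron; rows beyond the sixth repeat the
   first one. *)
Definition ico_mx d : 'M[R]_(d, 3) :=
  \matrix_(i, j) (nth [:: 0; ico_a; ico_b] ico_axes i)`_j.

Lemma ico_correlation d : correlation_matrices R d (ico_mx d *m (ico_mx d)^T).
Proof.
split=> [|i]; first exact: psd_gram.
have [ab1 _ _ _] := ico_ab.
rewrite mxE !big_ord_recl big_ord0 !mxE /=.
by case: i => [[|[|[|[|[|[|i]]]]]] id] /=; rewrite ?nth_nil /=; nra.
Qed.

(** The three relations say that [x i] is the inner product of the [i]-th axis with some
    [y = (a, b, c)]. The sum then equals [6/5 (|y|^2 - 3)^2], a pointwise form of Jensen's
    inequality at [|y|^2 = 3]. *)
Lemma ico_quartic (x : 'I_6 -> R) :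
  let w (s : seq R) := \sum_(i < 6) s`_i * x i in
  w [:: ico_b; ico_b; 0; 0; - ico_a; ico_a] = 0 ->
  w [:: ico_a; - ico_a; - ico_b; - ico_b; 0; 0] = 0 ->
  w [:: 0; 0; ico_a; - ico_a; - ico_b; - ico_b] = 0 ->
  0 <= \sum_i (x i ^+ 4 - 18 / 5 * x i ^+ 2 + 9 / 5).
Proof.
have [ab1 ab2 a0 b0] := ico_ab.
move=> w; rewrite /w !big_ord_recl !big_ord0 /=.
move: (x _) (x _) (x _) (x _) (x _) (x _) => x5 x4 x3 x2 x1 x0.
move: ico_a ico_b ab1 ab2 a0 b0 => u v uv1 uv2 u0 v0 r1 r2 r3.
(* The coordinates of [y] are read off from sums and differences within the pairs of axes; the
   relations make the remaining sums and differences consistent. *)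
pose a := (x4 + x5) / (2 * u); pose b := (x0 + x1) / (2 * u).
pose c := (x0 - x1) / (2 * v).
have e0 : x0 = u * b + v * c by rewrite /b /c; field; rewrite u0 v0.
have e1 : x1 = u * b - v * c by rewrite /b /c; field; rewrite u0 v0.
have vb : v * b = (x4 - x5) / 2.
  rewrite [LHS](_ : _ = v * (x0 + x1) / (2 * u)); last by rewrite /b mulrA.
  rewrite (_ : v * (x0 + x1) = u * (x4 - x5)); last by lra.
  by field.
have ua : u * a = (x4 + x5) / 2 by rewrite /a; field.
have e4 : x4 = u * a + v * b by lra.
have e5 : x5 = u * a - v * b by lra.
have s23 : x2 + x3 = 2 * u * c.
  rewrite [LHS](_ : _ = v * (x2 + x3) / v); last by field.
  rewrite (_ : v * (x2 + x3) = u * (x0 - x1)); last by lra.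
  by rewrite /c; field.
have d23 : x2 - x3 = 2 * v * a.
  rewrite [LHS](_ : _ = u * (x2 - x3) / u); last by field.
  rewrite (_ : u * (x2 - x3) = v * (x4 + x5)); last by lra.
  by rewrite /a; field.
have e2 : x2 = u * c + v * a by lra.
have e3 : x3 = u * c - v * a by lra.
clearbody a b c; rewrite {}e0 {}e1 {}e2 {}e3 {}e4 {}e5.
have uv4 : u ^+ 4 + v ^+ 4 = 3 / 5.
  rewrite [LHS](_ : _ = (u ^+ 2 + v ^+ 2) ^+ 2 - 2 * (u ^+ 2 * v ^+ 2)); last by ring.
  by rewrite uv1 uv2; field.
set n := a ^+ 2 + b ^+ 2 + c ^+ 2.
rewrite [leRHS](_ : _ = 2 * (u ^+ 4 + v ^+ 4) * (a ^+ 4 + b ^+ 4 + c ^+ 4) +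
  12 * (u ^+ 2 * v ^+ 2) * (a ^+ 2 * b ^+ 2 + b ^+ 2 * c ^+ 2 + c ^+ 2 * a ^+ 2) -
  36 / 5 * ((u ^+ 2 + v ^+ 2) * n) + 54 / 5); last by rewrite /n; field.
rewrite uv4 uv2 uv1 [leRHS](_ : _ = 6 / 5 * (n - 3) ^+ 2); last by rewrite /n; field.
by rewrite mulr_ge0 ?sqr_ge0 //; lra.
Qed.

End Icosahedron.

(** * The icosahedral matrix is not attained *)

Section NotRealizable.
Context (R : realType) (disp : measure_display) (T : measurableType disp)
  (P : probability T R).

Lemma ae_eq0_of_sqr_integral0 (f : T -> R) :
  P.-integrable [set: T] (EFin \o (fun t => f t ^+ 2)) ->
  \int[P]_x (f x ^+ 2) = 0 -> {ae P, forall t, f t = 0}.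
Proof.
move=> i2 E0; have mf : measurable_fun setT (EFin \o (fun t => f t ^+ 2)).
  by case/integrableP : i2.
pose g := EFin \o (fun t => f t ^+ 2).
have /ae_eq_integral_abs : (\int[P]_x `|g x| = 0)%E.
  rewrite (eq_integral g); last first.
    by move=> t _; rewrite /g /= ger0_norm ?sqr_ge0.
  by rewrite -[LHS]fineK ?integrable_fin_num // [fine _]E0.
move=> /(_ measurableT mf); apply: filterS => t /(_ I) gt0.
have /eqP : f t ^+ 2 = 0 by exact: EFin_inj gt0.
by rewrite sqrf_eq0 => /eqP.
Qed.

(** Such an [f] agrees almost everywhere with its absolute value. *)
Lemma Rintegral_ae_ge0 (f : T -> R) : P.-integrable [set: T] (EFin \o f) ->
  {ae P, forall t, 0 <= f t} -> 0 <= \int[P]_x f x.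
Proof.
move=> fi f0; have mf : measurable_fun setT (EFin \o f) by case/integrableP : fi.
rewrite /Rintegral (ae_eq_integral (abse \o (EFin \o f))) //.
- by rewrite fine_ge0 // integral_ge0 // => t _; exact: abse_ge0.
- exact: measurableT_comp.
- by apply: filterS f0 => t ft _ /=; rewrite ger0_norm.
Qed.

(** Kernel vectors of the Gram matrix give the relations of [ico_quartic] almost surely, so the
    quartic sum has nonnegative mean; the arcsine moments make that mean negative. *)
Lemma ico_not_margin (X : 'I_6 -> {RV P >-> R}) :
  (forall i, has_law (X i) (arcsine_law R)) ->
  correlation_matrix X = ico_mx R 6 *m (ico_mx R 6)^T -> False.
Proof.
move=> XF XE.
have zero (s : seq R) : (ico_mx R 6)^T *m (\col_(i < 6) s`_i) = 0 ->
    {ae P, forall t, \sum_(i < 6) s`_i * X i t = 0}.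
  move=> s0; have [i2] := arcsine_bform XF (\col_(i < 6) s`_i).
  rewrite XE /bform -!mulmxA s0 !mulmx0 mxE => E0.
  have := ae_eq0_of_sqr_integral0 i2 E0; apply: filterS => t.
  by under eq_bigr do rewrite mxE.
have /zero Z1 : (ico_mx R 6)^T *m (\col_(i < 6)
    ([:: ico_b R; ico_b R; 0; 0; - ico_a R; ico_a R] : seq R)`_i) = 0.
  apply/colP => k; rewrite !mxE !big_ord_recl big_ord0 !mxE /=.
  by case: k => [[|[|[|k]]] kd] //=; ring.
have /zero Z2 : (ico_mx R 6)^T *m (\col_(i < 6)
    ([:: ico_a R; - ico_a R; - ico_b R; - ico_b R; 0; 0] : seq R)`_i) = 0.
  apply/colP => k; rewrite !mxE !big_ord_recl big_ord0 !mxE /=.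
  by case: k => [[|[|[|k]]] kd] //=; ring.
have /zero Z3 : (ico_mx R 6)^T *m (\col_(i < 6)
    ([:: 0; 0; ico_a R; - ico_a R; - ico_b R; - ico_b R] : seq R)`_i) = 0.
  apply/colP => k; rewrite !mxE !big_ord_recl big_ord0 !mxE /=.
  by case: k => [[|[|[|k]]] kd] //=; ring.
pose h i t := X i t ^+ 4 - 18 / 5 * X i t ^+ 2 + 9 / 5.
(* The mean is [3/2 - 18/5 + 9/5], from fourth moment [3/2] and second moment 1. *)
have hP i : P.-integrable [set: T] (EFin \o h i) /\ \int[P]_x h i x = - (3 / 10).
  have [i2 E2] := arcsine_moment2 (XF i); have [i4 E4] := arcsine_moment4 (XF i).
  have ic : P.-integrable [set: T] (EFin \o (fun=> 9 / 5 : R)).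
    exact: finite_measure_integrable_cst.
  have i2' : P.-integrable [set: T] (EFin \o (fun t => 18 / 5 * X i t ^+ 2)).
    by have := integrableZl measurableT (18 / 5) i2; apply: eq_integrable.
  have i42 : P.-integrable [set: T] (EFin \o (fun t => X i t ^+ 4 - 18 / 5 * X i t ^+ 2)).
    by have := integrableB measurableT i4 i2'; apply: eq_integrable.
  split; first by have := integrableD measurableT i42 ic; apply: eq_integrable.
  rewrite RintegralD // RintegralB // RintegralZl // E2 E4 Rintegral_cst //.
  by rewrite [X in fine X]probability_setT /=; field.
have [hi hE] := integrable_sum_fun (fun i => (hP i).1).
have : 0 <= \int[P]_x (\sum_(i < 6) h i x).
  apply: Rintegral_ae_ge0 => //.
  apply: filterS3 Z1 Z2 Z3 => t; exact: (@ico_quartic R (fun i => X i t)).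
rewrite hE; under eq_bigr do rewrite (hP _).2.
by rewrite sumr_const card_ord; lra.
Qed.

End NotRealizable.

Theorem theorem4p1 (R : realType) (d : nat) (hd : (1 <= d)%N) :
  margin_correlation_matrices (arcsine_law R) d = correlation_matrices R d
  <-> (d <= 5)%N.
Proof.
split=> [SP|d5]; last first.
  apply/seteqP; split=> A; last exact: correlation_matrices_margin.
  by move=> [disp [T [P [X [XF ->]]]]]; exact: arcsine_correlation_matrix.
rewrite leqNgt; apply/negP => d6.
have : margin_correlation_matrices (arcsine_law R) d (ico_mx R d *m (ico_mx R d)^T).
  by rewrite SP; exact: ico_correlation.
move=> [disp [T [P [X [XF XE]]]]].
(* The first six variables attain the leading 6 by 6 block, which is the icosahedral matrix
   itself. *)
apply: (@ico_not_margin R disp T P (fun i => X (widen_ord d6 i))) => [i|]; first exact: XF.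
apply/matrixP => i j; move/matrixP/(_ (widen_ord d6 i) (widen_ord d6 j)) : XE.
rewrite !mxE => <-.
by apply: eq_bigr => k _; rewrite !mxE.
Qed.
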